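(* Let $n\in\mathbb{Z}^+$ and let $G$ be a simple graph with $\chi(G)$ finite. Then a proper closed coloring with nonzero remainders mod $n$ of $G$ exists if and only if a (not necessarily proper) closed coloring with nonzero remainders mod $n$ of $G$ exists. In that case, \[ \chi(G)\le \chi_{n}(G) \leq n \, \chi(G). \] More precisely, if $\ell$ is a closed labeling with nonzero remainders mod $n$ of $G$, then \[ \chi(G) \le \chi_{n}(G) \leq |\ell| \, \chi(G).\]
   Context: Graphs are simple (possibly infinite) graphs $G=(V,E)$. A $\mathbb{Z}$-labeling (coloring) of $G$ is a map $\ell:V\to\mathbb{Z}$; its order $|\ell|$ is the size of its range. It is proper if adjacent vertices get different labels; $\chi(G)$ is the minimum order of a proper labeling. $N[v]$ denotes the closed neighborhood of $v$ ($v$ together with its neighbors). For $n\in\mathbb{Z}^+$, a closed coloring with nonzero remainders mod $n$ is a labeling $\ell$ with $\sum_{w\in N[v]}\ell(w)\not\equiv 0 \pmod n$ for every $v\in V$. If no proper such coloring exists, $\chi_n(G)$ does not exist; if proper such colorings of finite order exist, $\chi_n(G)$ is the minimum order of a proper closed coloring with nonzero remainders mod $n$; if they exist only of infinite order, $\chi_n(G)=\infty$. *)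

(* Defs.v *)
From HB Require Import structures.
From mathcomp Require Import all_boot all_order all_algebra finmap.
From mathcomp Require Import mathcomp_extra boolp classical_sets functions.
From mathcomp Require Import cardinality fsbigop constructive_ereal.

Set Implicit Arguments.
Unset Strict Implicit.
Unset Printing Implicit Defensive.
Import Order.TTheory GRing.Theory Num.Theory.

Local Open Scope classical_set_scope.
Local Open Scope ring_scope.

Record sgraph (V : choiceType) := SGraph {
  adj : V -> V -> Prop;
  adj_sym : forall u v, adj u v -> adj v u;
  adj_irr : forall v, ~ adj v v }.

Definition closed_nbhd (V : choiceType) (G : sgraph V) (v : V) : set V :=
  [set w | w = v \/ adj G v w].

(* Number of labels used: a nonnegative integer, or +oo. *)
Definition label_order (V : choiceType) (l : V -> int) : \bar int :=
  if `[< finite_set (range l) >] then (#|` fset_set (range l) |%:Z)%:E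
  else +oo%E.

Definition proper_labeling (V : choiceType) (G : sgraph V) (l : V -> int) : Prop :=
  forall u v, adj G u v -> l u <> l v.

(* The sum over N[v] is only meaningful when N[v] is finite (the big operator
   returns a junk value on an infinite support), hence the first conjunct. *)
Definition closed_coloring (n : nat) (V : choiceType) (G : sgraph V)
    (l : V -> int) : Prop :=
  forall v, finite_set (closed_nbhd G v) /\
    (\sum_(w \in closed_nbhd G v) l w != 0 %[mod n%:Z])%Z.

Definition is_minimum (A : set (\bar int)) (x : \bar int) : Prop :=
  A x /\ lbound A x.

(* The invariants below are predicates ("x is the value"), so that an invariant
   which does not exist simply has no value, while the value +oo means that
   suitable labelings exist but all of them have infinite order. *)
Definition is_chi (V : choiceType) (G : sgraph V) (x : \bar int) : Prop :=
  is_minimum [set label_order l | l in [set l | proper_labeling G l]] x.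

Definition is_chi_mod (n : nat) (V : choiceType) (G : sgraph V)
    (x : \bar int) : Prop :=
  is_minimum
    [set label_order l |
      l in [set l | proper_labeling G l /\ closed_coloring n G l]] x.

(* Main.v *)
(* Given a closed coloring l and a proper labeling p, the labeling
   (l v mod n) + n * p v has the same sums over closed neighborhoods as l
   modulo n, and it is proper because p can be recovered from it by division
   by n. Its label is determined by l v (or by l v mod n) together with p v,
   which bounds its order. *)
Require Import Defs.
From mathcomp Require Import all_boot all_order all_algebra finmap.
From mathcomp Require Import boolp classical_sets.
From mathcomp Require Import cardinality fsbigop constructive_ereal.
Import Order.TTheory GRing.Theory Num.Theory.

Local Open Scope ereal_scope.

Lemma label_order_finite (V : choiceType) (l : V -> int) :
  finite_set (range l) ->
  label_order l = (#|` fset_set (range l)|%:Z)%:E.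
Proof. by move=> fin; rewrite /label_order asboolT. Qed.

Lemma label_order_infinite (V : choiceType) (l : V -> int) :
  ~ finite_set (range l) -> label_order l = +oo.
Proof. by move=> inf; rewrite /label_order asboolF. Qed.

Lemma label_order_fin_num (V : choiceType) (l : V -> int) :
  label_order l \is a fin_num -> finite_set (range l).
Proof.
by move=> lfin; apply: contrapT => /label_order_infinite e; rewrite e in lfin.
Qed.

(** Finite orders are natural numbers, so a least one exists by well-ordering; labelings of infinite
    order have value [+oo] and cannot go below it. *)
Lemma label_order_minimum (V : choiceType) (P : set (V -> int)) :
  (exists2 l, P l & label_order l \is a fin_num) ->
  exists x, is_minimum [set label_order l | l in P]%classic x.
Proof.
move=> [l0 Pl0 /label_order_fin_num fin0].
pose Q k := `[< exists2 l, P l & label_order l = (k%:Z)%:E >].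
have exQ : exists k, Q k.
  exists #|` fset_set (range l0)|; apply/asboolP.
  by exists l0 => //; exact: label_order_finite.
have [k /asboolP[l Pl lk] kmin] := ex_minnP exQ.
exists (k%:Z)%:E; split; first by exists l.
move=> _ [l' Pl' <-].
have [fin'|inf'] := pselect (finite_set (range l')); last first.
  by rewrite label_order_infinite ?leey.
rewrite label_order_finite // lee_fin lez_nat; apply: kmin.
by apply/asboolP; exists l' => //; exact: label_order_finite.
Qed.

(** Every label occurs in the list of all values [f (a, b)], whose length, repetitions included, is
    the product of the two cardinalities. Both upper bounds on the order come from this count. *)
Lemma label_order_pair (V : choiceType) (A B : set int) (f : int * int -> int)
    (l : V -> int) :
  finite_set A -> finite_set B ->
  (forall v, exists2 ab, (A `*` B)%classic ab & f ab = l v) ->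
  label_order l <= ((#|` fset_set A| * #|` fset_set B|)%N%:Z)%:E.
Proof.
move=> finA finB lf.
have finAB := finite_setX finA finB.
have finI := finite_image f finAB.
have sub : (range l `<=` f @` (A `*` B))%classic.
  by move=> _ [v _ <-]; have [ab ABab <-] := lf v; exists ab.
have finl := sub_finite_set sub finI.
rewrite label_order_finite // lee_fin lez_nat -(size_allpairs (fun a b => f (a, b))).
apply: uniq_leq_size => [|x]; first exact: fset_uniq.
rewrite in_fset_set // => /set_mem/sub[[a b] [Aa Bb] <-].
by apply: allpairs_f; rewrite in_fset_set //; apply: mem_set.
Qed.

(** Finiteness of [A] turns both sides into ordinary finite sums, which are compared term by
    term. *)
Lemma eq_fsbig_mod (n : nat) (V : choiceType) (A : set V) (l q : V -> int) :
  finite_set A -> (forall v, (q v = l v %[mod n%:Z])%Z) ->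
  (\sum_(w \in A) q w = \sum_(w \in A) l w %[mod n%:Z])%Z%R.
Proof.
move=> finA ql; rewrite !fsbig_finite //=.
elim/big_rec2: _ => // v x y _ xy.
by rewrite -modzDm ql xy modzDm.
Qed.

Definition modular_labeling (n : nat) (ab : int * int) : int :=
  ((ab.1 %% n%:Z)%Z + ab.2 * n%:Z)%R.

Lemma modular_labeling_mod (n : nat) (a b : int) :
  (modular_labeling n (a, b) = a %[mod n%:Z])%Z.
Proof. by rewrite /modular_labeling /= addrC modzMDl modz_mod. Qed.

(** The remainder lies in [0, n), so division by [n] discards it. *)
Lemma modular_labeling_div (n : nat) (a b : int) : (0 < n)%N ->
  (modular_labeling n (a, b) %/ n%:Z)%Z = b.
Proof.
move=> n_gt0; have n0 : (n%:Z != 0)%R by rewrite -lt0n.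
rewrite /modular_labeling /= addrC divzMDl // divz_small ?addr0 //.
by rewrite modz_ge0 //= ltz_mod.
Qed.

Theorem theorem3p3 (n : nat) (n_gt0 : (0 < n)%N) (V : choiceType)
    (G : sgraph V) (chi : \bar int) (chiP : is_chi G chi)
    (chi_fin : chi \is a fin_num) :
  ((exists l : V -> int,
      proper_labeling G l /\ closed_coloring n G l) <->
   (exists l : V -> int, closed_coloring n G l)) /\
  ((exists l : V -> int, closed_coloring n G l) ->
   exists chi_n : \bar int,
     is_chi_mod n G chi_n /\ chi <= chi_n /\ chi_n <= (n%:Z)%:E * chi) /\
  (forall l : V -> int, closed_coloring n G l ->
   exists chi_n : \bar int,
     is_chi_mod n G chi_n /\ chi <= chi_n /\ chi_n <= label_order l * chi).
Proof.
have [[p p_proper pchi] chi_lb] := chiP.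
have finp : finite_set (range p) by apply: label_order_fin_num; rewrite pchi.
have chiE : chi = (#|` fset_set (range p)|%:Z)%:E.
  by rewrite -pchi label_order_finite.
pose q l v := modular_labeling n (l v, p v).
have q_proper l : proper_labeling G (q l).
  move=> u v uv quv; apply: (p_proper _ _ uv).
  by rewrite -(modular_labeling_div n (l u) (p u) n_gt0)
             -(modular_labeling_div n (l v) (p v) n_gt0) -/(q l u) quv.
have q_closed l : closed_coloring n G l -> closed_coloring n G (q l).
  move=> lc v; have [finv sumv] := lc v; split=> //.
  rewrite ((eq_fsbig_mod n _ _ l)) // => w; exact: modular_labeling_mod.
have q_order_n l : label_order (q l) <= (n%:Z)%:E * chi.
  have finI : finite_set (Posz @` `I_n)%classic.
    by apply: finite_image; exact: finite_II.
  apply: le_trans (label_order_pair _ _ _ (modular_labeling n) _ finI finp _) _.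
    (* Reducing [l v] first leaves the label unchanged, since taking remainders is idempotent, and
       confines the first coordinate to the [n] residues 0, ..., n - 1. *)
    move=> v; exists ((l v %% n%:Z)%Z, p v); last first.
      by rewrite /q /modular_labeling /= modz_mod.
    split; last by exists v.
    have n0 : (n%:Z != 0)%R by rewrite -lt0n.
    exists `|(l v %% n%:Z)%Z|%N; last by rewrite gez0_abs ?modz_ge0.
    by rewrite /= -ltz_nat gez0_abs ?modz_ge0 // ltz_mod.
  rewrite chiE -EFinM lee_fin -PoszM lez_nat leq_mul2r; apply/orP; right.
  by apply: geq_card_fset_set; exact: card_image_le.
have q_order l : label_order (q l) <= label_order l * chi.
  have [finl|infl] := pselect (finite_set (range l)).
    rewrite (label_order_finite _ _ finl) chiE -EFinM -PoszM.
    (* Here the first coordinate is the unreduced [l v], so that the count involves the range of [l]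
       instead of the residues. *)
    apply: (label_order_pair _ _ _ (modular_labeling n)) => // v.
    by exists (l v, p v) => //; split; exists v.
  (* [+oo * chi] is [0] when [chi = 0], but then the graph is empty. *)
  rewrite (label_order_infinite _ _ infl) chiE gt0_mulye ?leey //.
  rewrite lte_fin ltz_nat lt0n; apply/eqP => /cardfs0_eq.
  move=> /(fset_set_set0 finp) p0; apply: infl.
  have -> : range l = set0; last exact: finite_set0.
  rewrite -subset0 => y [v _ _].
  have : range p (p v) by exists v.
  by rewrite p0.
have min_ex l : closed_coloring n G l ->
    exists chi_n, is_chi_mod n G chi_n /\ chi <= chi_n /\
      chi_n <= label_order (q l).
  move=> lc; have Pq := conj (q_proper l) (q_closed l lc).
  have [|x [xin xlb]] := label_order_minimum
      _ [set l | proper_labeling G l /\ closed_coloring n G l]%classic.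
    (* [q l] has finite order even when [l] does not: the bound n * [chi] is finite and rules out
       [+oo]. *)
    exists (q l) => //; apply: contraT => /negP nfin.
    have := q_order_n l; rewrite chiE -EFinM.
    rewrite {1}/label_order; case: asboolP nfin => // fin [].
    by rewrite label_order_finite.
  exists x; split; first by [].
  split; last by apply: xlb; exists (q l).
  (* The minimum is attained by a proper labeling [r], which also competes in the definition of
     [chi]. *)
  by have [r [r_proper _] <-] := xin; apply: chi_lb; exists r.
split; [|split].
- split=> [[l [_ lc]]|[l lc]]; first by exists l.
  by exists (q l); split; [exact: q_proper|exact: q_closed].
- move=> [l /min_ex[x [xmin [chix xq]]]]; exists x; split=> //; split=> //.
  exact: le_trans xq (q_order_n l).
- move=> l /min_ex[x [xmin [chix xq]]]; exists x; split=> //; split=> //.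
  exact: le_trans xq (q_order l).
Qed.
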